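(* If $G$ is a finite, simple, connected, uniquely dimensional graph of order $n$ and diameter $d$, then $\beta(G)\leq n-d-2$.
   Context: For vertices $u,v$ of a connected graph $G$, $d(u,v)$ is the distance between them; the diameter is $\max_{u,v} d(u,v)$. For an ordered set $W=\{w_1,\dots,w_k\}\subseteq V(G)$ and $v\in V(G)$, $r(v|W)=(d(v,w_1),\dots,d(v,w_k))$. $W$ is a resolving set if distinct vertices have distinct representations $r(\cdot|W)$. A resolving set of minimum cardinality is a metric basis; its cardinality is the metric dimension $\beta(G)$. $G$ is uniquely dimensional if it has exactly one metric basis.
   Formalization: The graph is assumed to have order n at least 2; for the one-vertex graph (n = 1, d = 0, unique basis the empty set, dimension 0) the claimed bound would read 0 ≤ -1 and is false. *)

(* Defs.v *)
(* A simple graph on T is a symmetric irreflexive e : rel T. *)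
From mathcomp Require Import all_boot.

Set Implicit Arguments.
Unset Strict Implicit.
Unset Printing Implicit Defensive.

Section Graph.
Variables (T : finType) (e : rel T).
Implicit Types (u v : T) (S : {set T}).

Definition connected_graph : Prop := 0 < #|T| /\ forall u v, connect e u v.

Definition has_walk (u v : T) (k : nat) : bool :=
  [exists p : k.-tuple T, path e u p && (last u p == v)].

(* A shortest walk has length < #|T|, so the search is exhaustive; it returns
   #|T| exactly when v is unreachable from u. See distP below. *)
Definition dist (u v : T) : nat := find (has_walk u v) (iota 0 #|T|).

Definition diameter : nat := \max_(u : T) \max_(v : T) dist u v.

Definition representation (v : T) (W : seq T) : seq nat :=
  [seq dist v w | w <- W].

(* W is ordered by the enumeration of T; being resolving does not depend on
   the order, see resolvingP. *)
Definition resolving (W : {set T}) : bool :=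
  injectiveb (fun v => representation v (enum W)).

(* The default setT of the arg min is resolving, see resolvingT. *)
Definition metric_dimension : nat :=
  #|[arg min_(W < setT | resolving W) #|W| ]|.

Definition metric_basis (W : {set T}) : Prop :=
  resolving W /\ forall W' : {set T}, resolving W' -> #|W| <= #|W'|.

Definition uniquely_dimensional : Prop :=
  exists! W : {set T}, metric_basis W.

Lemma has_walkP u v k :
  reflect (exists p, [/\ size p = k, path e u p & last u p = v])
          (has_walk u v k).
Proof.
apply: (iffP existsP) => [[p /andP[ep /eqP lp]]|[p [sp ep lp]]].
  by exists p; rewrite size_tuple.
by exists (Tuple (introT eqP sp)); rewrite /= ep lp eqxx.
Qed.

Lemma distP u v : connect e u v ->
  has_walk u v (dist u v) /\ forall k, has_walk u v k -> dist u v <= k.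
Proof.
move=> /connectP[p0 ep0 lp0]; case/shortenP: ep0 lp0 => p ep up _ lp.
have szp : size p < #|T|.
  by have := card_uniqP up; have /= := max_card [in u :: p] => + E; rewrite E.
have hw : has (has_walk u v) (iota 0 #|T|).
  apply/hasP; exists (size p); first by rewrite mem_iota.
  by apply/has_walkP; exists p.
have ltd : dist u v < #|T| by move: hw; rewrite has_find size_iota.
split; first by have := nth_find 0 hw; rewrite nth_iota.
move=> k hk; case: leqP => // ltk.
have := before_find 0 ltk; rewrite nth_iota ?add0n ?hk //.
exact: ltn_trans ltd.
Qed.

Lemma dist_eq0 u v : (dist u v == 0) = (u == v).
Proof.
have T0 : 0 < #|T| by apply/card_gt0P; exists u.
apply/eqP/eqP => [d0|<-].
  have lt : find (has_walk u v) (iota 0 #|T|) < size (iota 0 #|T|).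
    by rewrite size_iota -/(dist u v) d0.
  rewrite -has_find in lt; have := nth_find 0 lt.
  rewrite -/(dist u v) d0 nth_iota // => /has_walkP[p [/size0nil-> _]].
  by [].
have [_] := distP (connect0 e u); move/(_ 0) => H.
by apply/eqP; rewrite -leqn0 H //; apply/has_walkP; exists [::].
Qed.

Lemma resolvingP (W : {set T}) :
  reflect (forall u v, u != v -> exists2 w, w \in W & dist u w != dist v w)
          (resolving W).
Proof.
apply: (iffP (injectiveP _)) => [inj u v uv|H u v /eq_in_map E].
  apply/exists_inP; apply: contraNT uv; rewrite negb_exists_in => /forall_inP H.
  apply/eqP/inj/eq_in_map => w; rewrite mem_enum => /H.
  by rewrite negbK => /eqP.
apply/eqP; apply: contraT => /H[w wW].
by rewrite E ?eqxx // mem_enum.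
Qed.

Lemma resolvingT : resolving setT.
Proof.
apply/resolvingP => u v uv; exists u; rewrite ?inE //.
have /eqP-> : dist u u == 0 by rewrite dist_eq0.
by rewrite eq_sym dist_eq0 eq_sym.
Qed.

Lemma metric_basis_card (W : {set T}) :
  metric_basis W <-> resolving W /\ #|W| = metric_dimension.
Proof.
rewrite /metric_dimension; case: arg_minnP => [|M rM minM].
  exact: resolvingT.
split=> [[rW minW]|[rW cW]]; last by split=> // W' rW'; rewrite cW minM.
by split=> //; apply/eqP; rewrite eqn_leq minW ?minM.
Qed.

End Graph.

(* Main.v *)
(* Let C be the complement of the unique basis; enlarging the basis is harmless,
   so complements of resolving sets (co-resolving sets) are closed under
   subsets. Let d u v = D be the diameter. A shortest path from u to v minus u,
   or minus v, is co-resolving of size D, so uniqueness excludes dimension n - D.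
   Suppose the dimension is n - D - 1, i.e. C is the only co-resolving set of
   size D + 1 and none is larger.

   Call the spheres around u levels. A transversal of the levels 1..D plus one
   extra vertex y is co-resolving as soon as an outside vertex z separates y from
   its level mate. Exchanging vertices in such a configuration gives a second set
   of size D + 1, unless z is alone in its level. Hence two vertices with the same
   distances to u and to v are separated only by themselves; such twins are
   interchangeable, so by uniqueness they lie outside C. In the same way u and v
   are each other's only antipodes.

   A transversal of the classes of equal distances to u and v, minus u and v, is
   co-resolving, so there are at most D + 3 classes. With at most D + 2 of them
   all vertices outside C are twins of one vertex b, whence the D + 1 vertices of C
   have distinct distances to b in 1..D, which is absurd. With D + 3 of them all
   classes are singletons, C = V \ {u, v}, and exactly two vertices x, y lie off
   the path; comparing their distances to the path shows that they have the same
   distances to u and v, a contradiction. *)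
Require Import Defs.
From mathcomp Require Import all_boot all_order all_algebra.
From mathcomp Require Import perm zify.
Set Implicit Arguments.
Unset Strict Implicit.
Unset Printing Implicit Defensive.
Import Order.TTheory GRing.Theory Num.Theory.

(** * Graph distance as a geodesic metric *)

Section GraphDistance.
Variables (T : finType) (e : rel T).
Hypotheses (e_sym : symmetric e) (e_conn : forall u v, connect e u v).

Lemma dist_leP u v k :
  reflect (exists2 j, j <= k & has_walk e u v j) (dist e u v <= k).
Proof.
have [w m] := distP (e_conn u v).
apply: (iffP idP) => [le|[j le /m]]; first by exists (dist e u v).
by move=> h; apply: leq_trans le.
Qed.

Lemma has_walk_sym u v k : has_walk e u v k -> has_walk e v u k.
Proof.
move=> /has_walkP[p [sp ep <-]]; apply/has_walkP; exists (rev (belast u p)).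
split; first by rewrite size_rev size_belast.
  by rewrite rev_path; under eq_path => x y do rewrite /= e_sym.
by case: p {sp ep} => //= x p; rewrite rev_cons last_rcons.
Qed.

Lemma dist_sym u v : dist e u v = dist e v u.
Proof.
have le a b : dist e a b <= dist e b a.
  apply/dist_leP; exists (dist e b a) => //; apply: has_walk_sym.
  by case: (distP (e_conn b a)).
by apply/eqP; rewrite eqn_leq !le.
Qed.

Lemma dist_triangle u v w : dist e u w <= dist e u v + dist e v w.
Proof.
have [/has_walkP[p [sp ep lp]] _] := distP (e_conn u v).
have [/has_walkP[q [sq eq lq]] _] := distP (e_conn v w).
apply/dist_leP; exists (dist e u v + dist e v w) => //.
apply/has_walkP; exists (p ++ q).
by rewrite size_cat sp sq cat_path last_cat lp ep.
Qed.

Lemma dist_step u v n : dist e u v = n.+1 ->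
  exists2 w, dist e u w = 1 & dist e w v = n.
Proof.
move=> duv; have [] := distP (e_conn u v); rewrite duv.
move=> /has_walkP[[|w p] [//= [sp] /andP[euw ep] lp]] _.
have dwv : dist e w v <= n.
  by apply/dist_leP; exists n => //; apply/has_walkP; exists p.
have duw : dist e u w <= 1.
  apply/dist_leP; exists 1 => //; apply/has_walkP.
  by exists [:: w]; rewrite /= euw.
have := dist_triangle u w v.
by exists w; lia.
Qed.

End GraphDistance.

(** * Geodesics and co-resolving sets in an abstract integer metric *)

Section GeodesicMetric.
Variables (T : finType) (d : T -> T -> nat).
Hypotheses (d_eq0 : forall x y, (d x y == 0) = (x == y))
  (d_sym : forall x y, d x y = d y x)
  (d_tri : forall x y z, d x z <= d x y + d y z)
  (d_step : forall x y n, d x y = n.+1 -> exists2 z, d x z = 1 & d z y = n).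

Definition co_resolving (C : {set T}) : Prop :=
  forall x y, x \in C -> y \in C -> x != y ->
  exists2 z, z \notin C & d z x != d z y.

Definition twins (x y : T) : Prop :=
  forall z, z != x -> z != y -> d z x = d z y.

Lemma dxx x : d x x = 0.
Proof. by apply/eqP; rewrite d_eq0. Qed.

(** A discrete intermediate value theorem: along a geodesic from [a] to [b] the distance to [u]
    changes by at most 1 per step. *)
Lemma geodesic_through u j a b : d u a <= j <= d u b ->
  exists2 w, d u w = j & d a b = d a w + d w b.
Proof.
move=> /andP[]; move dab : (d a b) => n; elim: n a dab => [|n IH] a dab aj jb.
  have /eqP ab : a == b by rewrite -d_eq0 dab.
  by exists a; rewrite ?dxx ?dab //; subst; lia.
have [<-|ne] := eqVneq (d u a) j; first by exists a; rewrite ?dxx.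
have [w aw wb] := d_step dab.
have := d_tri u a w; rewrite aw => uw.
have [|w' uw' E] := IH w wb _ jb; first by lia.
exists w' => //; have := d_tri a w w'; have := d_tri a w' b; lia.
Qed.

Lemma co_resolving_perm C (s : {perm T}) :
  (forall a b, d (s a) (s b) = d a b) -> co_resolving C ->
  co_resolving (s @: C).
Proof.
move=> sd cC _ _ /imsetP[x xC ->] /imsetP[y yC ->] nxy.
have [|z zC zxy] := cC x y xC yC; first by apply: contraNneq nxy => ->.
by exists (s z); rewrite ?sd // mem_imset //; apply: perm_inj.
Qed.

Lemma twins_tperm x y : twins x y ->
  forall a b, d (tperm x y a) (tperm x y b) = d a b.
Proof.
move=> tw a b.
case: tpermP => [->|->|/eqP ax /eqP ay];
  case: tpermP => [->|->|/eqP bx /eqP b_y] //.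
- by rewrite !dxx.
- by rewrite d_sym -tw // d_sym.
- by rewrite !dxx.
- by rewrite d_sym tw // d_sym.
- by rewrite tw.
- by rewrite tw.
Qed.

Variable D : nat.
Hypothesis d_le : forall x y, d x y <= D.

Lemma geodesic_exists u v : d u v = D -> exists f : nat -> T,
  [/\ f 0 = u, f D = v & forall k, k <= D ->
      d u (f k) = k /\ d v (f k) = D - k].
Proof.
move=> uv.
have H k : exists w, k <= D -> d u w = k /\ d v w = D - k.
  have [kD|] := leqP k D; last by exists u.
  have [|w uw E] := @geodesic_through u k u v; first by rewrite dxx uv.
  exists w => _; split => //; rewrite d_sym; lia.
pose P k w := (k <= D) ==> (d u w == k) && (d v w == D - k).
have H' k : exists w, P k w.
  by have [w Hw] := H k; exists w; apply/implyP => /Hw[-> ->]; rewrite !eqxx.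
exists (fun k => xchoose (H' k)).
have E k : k <= D -> d u (xchoose (H' k)) = k /\ d v (xchoose (H' k)) = D - k.
  by move=> kD; have /implyP/(_ kD)/andP[/eqP-> /eqP->] := xchooseP (H' k).
split => //.
  by apply/eqP; rewrite eq_sym -d_eq0; apply/eqP; case: (E 0).
by apply/eqP; rewrite eq_sym -d_eq0; case: (E D) => // _ ->; rewrite subnn.
Qed.

(** * Exchange of vertices within levels *)

Hypothesis co_uniq : forall C1 C2, co_resolving C1 -> co_resolving C2 ->
  #|C1| = D.+1 -> #|C2| = D.+1 -> C1 = C2.

Section Levels.
Variable u : T.

Definition level_section (f : nat -> T) := forall k, k <= D -> d u (f k) = k.

Definition upd (v : T) (f : nat -> T) (k : nat) := if k == d u v then v else f k.

Lemma upd_section v f : level_section f -> level_section (upd v f).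
Proof. by move=> sf k kD; rewrite /upd; case: eqP => // _; apply: sf. Qed.

(* For a level section f this is {y, f 1, ..., f D}. *)
Definition section_set (y : T) (f : nat -> T) : {set T} :=
  [set v | (v == y) || (v == f (d u v)) && (v != u)].

(** Members of different levels are separated by [u], which lies outside the set; the only two
    members sharing a level are [y] and its mate, separated by [z]. *)
Lemma section_set_co y z f : level_section f -> y != f (d u y) ->
  z != y -> z != f (d u z) -> d z (f (d u y)) != d z y ->
  co_resolving (section_set y f) /\ #|section_set y f| = D.+1.
Proof.
move=> sf yf zy zf res.
have f0 : f 0 = u by apply/eqP; rewrite eq_sym -d_eq0 sf.
have yu : y != u by apply: contraNneq yf => ->; rewrite dxx f0.
split.
  move=> x1 x2; rewrite !inE => x1C x2C x12.
  have [E|] := eqVneq (d u x1) (d u x2); last first.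
    by exists u => //; rewrite inE eqxx andbF orbF eq_sym.
  exists z; first by rewrite inE negb_or zy (negbTE zf).
  move: x1C x2C x12 E.
  move=> /orP[/eqP->|/andP[/eqP x1f _]] /orP[/eqP->|/andP[/eqP x2f _]].
  - by move=> /eqP.
  - by move=> _ E; rewrite x2f -E eq_sym.
  - by move=> _ E; rewrite x1f E.
  - by move=> + E; rewrite x1f x2f E eqxx.
have -> : section_set y f = y |: [set f (val k).+1 | k : 'I_D].
  apply/setP => v; rewrite !inE; congr orb.
  apply/andP/imsetP => [[/eqP vf vu]|[k _ ->]].
    have v0 : 0 < d u v by rewrite lt0n d_eq0 eq_sym.
    have vD : (d u v).-1 < D by have := d_le u v; lia.
    by exists (Ordinal vD) => //=; rewrite prednK.
  have E := sf _ (ltn_ord k); rewrite E eqxx; split => //.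
  by apply: contra_eq_neq E => ->; rewrite dxx.
rewrite cardsU1 card_imset ?card_ord.
  rewrite (_ : _ \notin _) //; apply: contra yf => /imsetP[k _ ->].
  by rewrite (sf _ (ltn_ord k)).
move=> k1 k2 /= E; apply: val_inj => /=.
by have := sf _ (ltn_ord k1); rewrite E sf // => -[].
Qed.

Lemma section_set_sep y1 z1 f1 y2 z2 f2 z :
  level_section f1 -> y1 != f1 (d u y1) ->
  z1 != y1 -> z1 != f1 (d u z1) -> d z1 (f1 (d u y1)) != d z1 y1 ->
  level_section f2 -> y2 != f2 (d u y2) ->
  z2 != y2 -> z2 != f2 (d u z2) -> d z2 (f2 (d u y2)) != d z2 y2 ->
  z != y1 -> z != f1 (d u z) -> z != u ->
  (z == y2) || (z == f2 (d u z)) -> False.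
Proof.
move=> s1 a1 b1 c1 e1 s2 a2 b2 c2 e2 zy zf zu zC2.
have [co1 card1] := section_set_co s1 a1 b1 c1 e1.
have [co2 card2] := section_set_co s2 a2 b2 c2 e2.
have /setP/(_ z) := co_uniq co1 co2 card1 card2.
by rewrite !inE zu (negbTE zy) (negbTE zf) !andbT /= zC2.
Qed.

(** If [z] separated [x] and [y], a section through [x] with extra vertex [y] and avoiding [z] would
    be co-resolving; an exchange then gives another such set containing [z]. *)
Lemma level_unresolved g x y z z' : level_section g ->
  d u x = d u y -> d u z = d u z' -> z != z' -> z != x -> z != y ->
  d z x = d z y.
Proof.
move=> sg xy zz' nzz' zx zy; apply/eqP; apply: contraT => res; exfalso.
have nxy : x != y by apply: contraNneq res => ->.
have zu : z != u.
  apply: contraNneq nzz' => E; move: zz'; rewrite E dxx => /esym/eqP.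
  by rewrite d_eq0.
have sx := upd_section x; have sy := upd_section y.
have [E|NE] := eqVneq (d u z) (d u x).
  (* Three vertices share a level: if neither [x] nor [y] separated the other two, all three
     distances would agree. *)
  have R : (d x y != d x z) || (d y x != d y z).
    move: res; rewrite (d_sym z x) (d_sym z y) (d_sym y x); lia.
  case/orP: R => R.
    by refine (@section_set_sep y z (upd x g) z x (upd y g) z
        _ _ _ _ _ _ _ _ _ _ _ _ _ _);
      do ?[exact: sx|exact: sy]; rewrite /upd ?E -?xy ?eqxx // eq_sym.
  by refine (@section_set_sep y z (upd x g) z y (upd x g) z
      _ _ _ _ _ _ _ _ _ _ _ _ _ _);
    do ?[exact: sx|exact: sy]; rewrite /upd ?E -?xy ?eqxx // eq_sym.
have NE' : (d u x == d u z) = false by rewrite eq_sym (negbTE NE).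
have sz := upd_section z; have sz' := upd_section z'.
have z'x : z' != x by apply: contraNneq NE => <-; rewrite zz'.
have z'y : z' != y by apply: contraNneq NE => E; rewrite xy -E zz'.
have section2 a b : level_section (upd a (upd b g)).
  by do 2!apply: upd_section.
(* If [z'] also separates [x] and [y], then [z] and [z'] trade places as section point and outside
   witness. *)
have [E|R] := eqVneq (d z' x) (d z' y); last first.
  by refine (@section_set_sep y z (upd x (upd z' g)) y z' (upd x (upd z g)) z
      _ _ _ _ _ _ _ _ _ _ _ _ _ _);
    rewrite // /upd -?xy -?zz' ?eqxx ?(negbTE NE) ?NE' ?eqxx ?orbT // eq_sym.
(* Otherwise [x] or [y] separates [z] from [z'] and serves as the outside witness for a set that
   doubles the level of [z]. *)
have R : (d x z' != d x z) || (d y z' != d y z).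
  move: res; rewrite (d_sym z x) (d_sym z y) (d_sym x z') (d_sym y z') E; lia.
case/orP: R => R.
  by refine (@section_set_sep y z (upd x (upd z' g)) z x (upd y (upd z' g)) z
      _ _ _ _ _ _ _ _ _ _ _ _ _ _);
    rewrite // /upd -?xy -?zz' ?eqxx ?(negbTE NE) ?NE' ?eqxx ?orbT // eq_sym.
by refine (@section_set_sep y z (upd x (upd z' g)) z y (upd x (upd z' g)) z
    _ _ _ _ _ _ _ _ _ _ _ _ _ _);
  rewrite // /upd -?xy -?zz' ?eqxx ?(negbTE NE) ?NE' ?eqxx ?orbT // eq_sym.
Qed.

End Levels.

(** * Twins and antipodes *)

Hypothesis co_max : forall C, co_resolving C -> #|C| <= D.+1.
Hypothesis card_gt1 : 1 < #|T|.
Variable C0 : {set T}.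
Hypotheses (co_C0 : co_resolving C0) (card_C0 : #|C0| = D.+1).

Lemma twins_sym x y : twins x y -> twins y x.
Proof. by move=> tw z zx zy; rewrite tw. Qed.

Lemma twins_notin x y : x != y -> twins x y -> x \notin C0.
Proof.
move=> nxy tw; apply/negP => xC.
have E : tperm x y @: C0 = C0.
  apply: co_uniq => //; last by rewrite card_imset //; apply: perm_inj.
  by apply: co_resolving_perm co_C0; apply: twins_tperm.
have yC : y \in C0 by rewrite -E; apply/imsetP; exists x; rewrite ?tpermL.
have [z zC /eqP[]] := co_C0 xC yC nxy.
by apply: tw; apply: contraNneq zC => ->.
Qed.

Lemma twins_eq x y : twins x y -> x \in C0 -> x = y.
Proof.
by move=> tw xC; apply/eqP; apply: contraLR xC => /twins_notin; apply.
Qed.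

Lemma C0_neqT : exists b, b \notin C0.
Proof.
have [x [y [_ _ nxy]]] := card_gt1P card_gt1.
case: (pickP (fun b => b \notin C0)) => [b|H]; first by exists b.
have [||z] := co_C0 _ _ nxy; rewrite ?H //; apply/negbNE; by rewrite H.
Qed.

Lemma inj_dist_onto w k : {in C0 &, injective (d w)} -> k <= D ->
  exists2 c, c \in C0 & d w c = k.
Proof.
move=> inj kD; pose h c : 'I_D.+1 := inord (d w c).
have hE c : h c = d w c :> nat by rewrite inordK // ltnS.
have hT : h @: C0 = setT.
  apply/eqP; rewrite eqEcard subsetT cardsT card_ord card_in_imset ?card_C0 ?leqnn //.
  by move=> c c' cC cC' /(congr1 val) /=; rewrite !hE; apply: inj.
have /imsetP[c cC E] : (inord k : 'I_D.+1) \in h @: C0 by rewrite hT inE.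
by exists c => //; rewrite -hE -E inordK.
Qed.

(** Otherwise [d u] is injective on the D + 1 vertices of [C0], hence meets every level, and a
    vertex outside [C0] has a twin inside. *)
Lemma level_nontwins u v : d u v = D ->
  ~ (forall x y, d u x = d u y -> twins x y).
Proof.
move=> uv H; have [b bC] := C0_neqT.
have inj : {in C0 &, injective (d u)}.
  by move=> c c' cC c'C /H/twins_eq; apply.
have [c cC /H/twins_eq E] := inj_dist_onto inj (d_le u b).
by move: bC; rewrite -E ?cC.
Qed.

(** A [z] alone in its level is a cut: geodesics from [u] to [x], [y], or from [x], [y] to [v], pass
    through it, so the distances to that end determine those to [z]. *)
Lemma level_twins u v x y : d u v = D -> d u x = d u y ->
  d v x = d v y \/ (exists2 v', d u v' = D & v' != v) -> twins x y.
Proof.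
move=> uv xy H z zx zy; have [f [f0 fD fP]] := geodesic_exists uv.
have sf : level_section u f by move=> k /fP[].
case: (pickP (fun z' => (d u z' == d u z) && (z' != z))) => [z'|single].
  move=> /andP[/eqP E nz].
  by apply: (level_unresolved sf xy (esym E)); rewrite // eq_sym.
have {}single w : d u w = d u z -> w = z.
  move=> /eqP E; have := single w.
  by rewrite /= E /= => /negbT; rewrite negbK => /eqP.
have [zlex|xltz] := leqP (d u z) (d u x).
  have [|w /single-> Ex] := @geodesic_through u (d u z) u x.
    by rewrite dxx.
  have [|w' /single-> Ey] := @geodesic_through u (d u z) u y.
    by rewrite dxx -xy.
  lia.
(* A second antipode of [u] is a level mate of [v], so [v] cannot separate [x] and [y]. *)
have Evxy : d v x = d v y.
  case: H => // -[v' uv' nv'].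
  have nE t : d u t = d u x -> v != t.
    by apply: contra_eq_neq => <-; rewrite uv; have := d_le u z; lia.
  apply: (level_unresolved (z' := v') sf xy); rewrite ?uv //.
  - by rewrite eq_sym.
  - exact: nE.
  - by apply: nE; rewrite xy.
have zD := d_le u z.
have [|w /single-> Ex] := @geodesic_through u (d u z) x v.
  by rewrite uv zD ltnW.
have [|w' /single-> Ey] := @geodesic_through u (d u z) y v.
  by rewrite uv zD -xy ltnW.
by move: Ex Ey; rewrite !(d_sym _ v) !(d_sym _ z); lia.
Qed.

Lemma antipode_uniq u v v' : d u v = D -> d u v' = D -> v' = v.
Proof.
move=> uv uv'; apply/eqP; apply: contraT => nv; exfalso.
apply: (level_nontwins uv) => x y xy.
by apply: level_twins uv xy _; right; exists v'.
Qed.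

(** * Classes of equal distances to the two ends of a diameter *)

Section Antipodes.
Variables (u v : T).
Hypotheses (uv : d u v = D).

Let vu : d v u = D. Proof. by rewrite d_sym. Qed.

Definition coord_eq x y := (d u x == d u y) && (d v x == d v y).

Lemma coord_eqP x y : reflect (d u x = d u y /\ d v x = d v y) (coord_eq x y).
Proof. by apply: (iffP andP) => -[/eqP ? /eqP ?]. Qed.

Lemma coord_twins x y : coord_eq x y -> twins x y.
Proof. by move=> /coord_eqP[E1 E2]; apply: level_twins uv E1 _; left. Qed.

(** [choose] returns the same element for equivalent predicates, so a whole class shares one
    representative. *)
Definition rep x := choose (coord_eq x) x.

Lemma rep_coord x : coord_eq x (rep x).
Proof. by apply: chooseP; apply/coord_eqP. Qed.

Lemma repP x y : reflect (rep x = rep y) (coord_eq x y).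
Proof.
apply: (iffP idP) => [xy|E]; last first.
  have /coord_eqP[] := rep_coord x; rewrite E => xu xv; apply/coord_eqP.
  by rewrite xu xv; have /coord_eqP[-> ->] := rep_coord y.
rewrite /rep; have /coord_eqP[E1 E2] := xy.
rewrite (eq_choose (Q := coord_eq y)); last by move=> z; rewrite /coord_eq E1 E2.
by apply: choose_id; rewrite /coord_eq ?E1 ?E2 !eqxx.
Qed.

Lemma coord_eq_endl y : coord_eq u y -> y = u.
Proof. by case/coord_eqP; rewrite dxx => /esym/eqP; rewrite d_eq0 => /eqP->. Qed.

Lemma coord_eq_endr y : coord_eq v y -> y = v.
Proof. by case/coord_eqP => _; rewrite dxx => /esym/eqP; rewrite d_eq0 => /eqP->. Qed.

Definition reps : {set T} := rep @: setT.

Lemma reps_co : co_resolving (reps :\ u :\ v).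
Proof.
move=> x y; rewrite !inE => /andP[_ /andP[_ /imsetP[x0 _ Ex]]].
move=> /andP[_ /andP[_ /imsetP[y0 _ Ey]]] nxy.
have [E1|R] := eqVneq (d u x) (d u y); last first.
  by exists u; rewrite // !inE eqxx andbF.
have [E2|R] := eqVneq (d v x) (d v y); last first.
  by exists v; rewrite // !inE eqxx.
case/eqP: nxy; rewrite Ex Ey; apply/repP/coord_eqP.
have /coord_eqP[-> ->] := rep_coord x0; have /coord_eqP[-> ->] := rep_coord y0.
by rewrite -Ex -Ey.
Qed.

Hypothesis D_gt0 : 0 < D.

Lemma card_reps : #|reps| = #|reps :\ u :\ v|.+2.
Proof.
have ur : u \in reps.
  by apply/imsetP; exists u => //; apply/esym/coord_eq_endl/rep_coord.
have vr : v \in reps.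
  by apply/imsetP; exists v => //; apply/esym/coord_eq_endr/rep_coord.
have nvu : v != u by rewrite -d_eq0 vu -lt0n.
by rewrite (cardsD1 u) ur (cardsD1 v (_ :\ _)) !inE nvu vr.
Qed.

Lemma rep_inj_C0 : {in C0 &, injective rep}.
Proof. by move=> x y xC yC /repP/coord_twins/twins_eq; apply. Qed.

(** A class meeting [C0] is a singleton, its members being twins. *)
Lemma rep_notin b : b \notin C0 -> rep b \in reps :\: rep @: C0.
Proof.
move=> bC; rewrite !inE; apply/andP; split; last by apply/imsetP; exists b.
apply/imsetP => -[c cC /esym/repP/coord_twins/twins_eq E].
by move: bC; rewrite -E ?cC.
Qed.

Lemma reps_many : D.+2 < #|reps|.
Proof.
rewrite ltnNge; apply/negP => le.
have le1 : #|reps :\: rep @: C0| <= 1.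
  rewrite cardsD (setIidPr _); last by rewrite imsetS ?subsetT.
  by rewrite card_in_imset ?card_C0; [lia|apply: rep_inj_C0].
have [b bC] := C0_neqT.
have tw z : z \notin C0 -> twins z b.
  move=> zC; apply/coord_twins/repP.
  by move/card_le1_eqP: le1; apply; apply: rep_notin.
(* An outside [z] separating two vertices of [C0] is a twin of [b], so [b] separates them too. *)
have inj : {in C0 &, injective (d b)}.
  move=> c c' cC c'C E; apply/eqP; apply: contraT => ncc.
  have [z zC] := co_C0 cC c'C ncc.
  have nin t w : t \in C0 -> w \notin C0 -> t != w.
    by move=> tC; apply: contraNneq => <-.
  by rewrite !(d_sym z) !(tw z zC) ?nin // !(d_sym _ b) E eqxx.
have [c cC /eqP] := inj_dist_onto inj (leq0n D).
by rewrite d_eq0 => /eqP E; move: bC; rewrite E cC.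
Qed.

Lemma C0_reps : C0 = reps :\ u :\ v.
Proof.
apply: co_uniq co_C0 reps_co card_C0 _.
by apply/eqP; rewrite eqn_leq (co_max reps_co) /=; have := reps_many; rewrite card_reps.
Qed.

Lemma notin_C0 b : b \notin C0 -> b = u \/ b = v.
Proof.
move=> bC; have := rep_notin bC; rewrite !inE => /andP[nC rS].
have tw : twins (rep b) b by apply/twins_sym/coord_twins/rep_coord.
have : rep b \notin C0 by apply: contraNN bC => rC; rewrite -(twins_eq tw).
rewrite C0_reps !inE rS andbT -negb_or negbK => /orP[]/eqP E; [right|left];
  have := rep_coord b; rewrite E => /coord_eqP[E1 E2].
  by apply: coord_eq_endr; apply/coord_eqP.
by apply: coord_eq_endl; apply/coord_eqP.
Qed.

Lemma card_T : #|T| = D.+3.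
Proof.
have nvu : u != v by rewrite -d_eq0 uv -lt0n.
have E : ~: C0 = [set u; v].
  apply/setP => b; rewrite !inE.
  apply/idP/orP => [/notin_C0[]->|[]/eqP->]; rewrite ?eqxx; auto.
    by rewrite C0_reps !inE eqxx andbF.
  by rewrite C0_reps !inE eqxx.
by rewrite -(cardsC C0) E cards2 nvu card_C0 addn2.
Qed.

Lemma coord_eq_eq x y : coord_eq x y -> x = y.
Proof.
move=> xy; have [xC|/notin_C0[]E] := boolP (x \in C0).
- exact: twins_eq (coord_twins xy) xC.
- by rewrite E in xy *; rewrite (coord_eq_endl xy).
- by rewrite E in xy *; rewrite (coord_eq_endr xy).
Qed.

(** * The two vertices off a diametral path *)

Variable f : nat -> T.
Hypothesis (f0 : f 0 = u) (fD : f D = v)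
  (fP : forall k, k <= D -> d u (f k) = k /\ d v (f k) = D - k).

(** A geodesic from [f i] to [v] meets level [j] in a point with the coordinates of [f j], and
    classes are now singletons. *)
Lemma path_dist i j : i <= j <= D -> d (f i) (f j) = j - i.
Proof.
move=> /andP[ij jD]; have [ui vi] := fP (leq_trans ij jD); have [uj vj] := fP jD.
have [|w uw E] := @geodesic_through u j (f i) v; first by rewrite ui uv ij.
suff Ew : w = f j.
  by move: E; rewrite Ew !(d_sym _ v) vi vj; lia.
apply: coord_eq_eq; apply/coord_eqP; split; first by rewrite uw uj.
have := d_tri u w v; have := d_tri u (f i) w; move: E.
by rewrite uw ui uv vj !(d_sym _ v) vi; lia.
Qed.

Definition on_path w := [exists k : 'I_D.+1, w == f k].

Lemma on_pathP w : reflect (exists2 k, k <= D & w = f k) (on_path w).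
Proof.
apply: (iffP existsP) => [[k /eqP E]|[k kD E]]; first by exists k => //; rewrite -ltnS.
by exists (Ordinal (n := D.+1) (m := k) kD); apply/eqP.
Qed.

Lemma off_path_coords w : ~~ on_path w ->
  [/\ d u w < D, d v w < D & D < d u w + d v w].
Proof.
move=> /on_pathP wP; split.
- rewrite ltn_neqAle d_le andbT; apply/eqP => /(antipode_uniq uv) E.
  by apply: wP; exists D; rewrite ?fD.
- rewrite ltn_neqAle d_le andbT; apply/eqP => /(antipode_uniq vu) E.
  by apply: wP; exists 0; rewrite ?f0.
have := d_tri u w v; rewrite uv (d_sym w) leq_eqVlt => /orP[/eqP E|//].
case: wP; exists (d u w); first exact: d_le.
apply: coord_eq_eq; apply/coord_eqP.
by have [-> ->] := fP (d_le u w); split => //; lia.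
Qed.

Section OffPath.
Variables (x y : T).
Hypotheses (xP : ~~ on_path x) (yP : ~~ on_path y)
  (xyP : forall w, on_path w \/ w = x \/ w = y).

(** With [y] not adjacent, all neighbours of [x] are on the path. Steps towards [u] and [v] lead to
    indices [(d u x).-1] and [D - (d v x).-1]; triangle inequalities through these fix the
    distances. *)
Lemma off_path_dist : d x y != 1 ->
  [/\ forall k, d u x <= k <= D -> d x (f k) = d v x + k - D,
      forall k, k + d v x <= D -> d x (f k) = d u x - k,
      d x (f (d u x).-1) = 1 &
      d u x + d v x <= D.+2].
Proof.
move=> xy1; have [ux vx s] := off_path_coords xP.
have dx0 w : d x w = 1 -> on_path w.
  move=> xw; case: (xyP w) => [//|[]E]; first by move: xw; rewrite E dxx.
  by move: xy1; rewrite -E xw.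
have n1 : d x (f (d u x).-1) = 1.
  have [|w xw wu] := @d_step x u (d u x).-1; first by rewrite d_sym; lia.
  have /on_pathP[k kD E] := dx0 _ xw.
  by move: wu xw; rewrite E d_sym; have [-> _ ->] := fP kD.
have n2 : d x (f (D - (d v x).-1)) = 1.
  have [|w xw wv] := @d_step x v (d v x).-1; first by rewrite d_sym; lia.
  have /on_pathP[k kD E] := dx0 _ xw.
  move: wv xw; rewrite E d_sym; have [_ ->] := fP kD.
  by move=> <- ; rewrite subKn.
split.
- move=> k /andP[ak kD]; have [_ vk] := fP kD.
  have P : d (f (D - (d v x).-1)) (f k) = k - (D - (d v x).-1).
    by apply: path_dist; lia.
  have := d_tri v (f k) x; have := d_tri x (f (D - (d v x).-1)) (f k).
  by rewrite (d_sym (f k) x); lia.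
- move=> k kb; have kD : k <= D by lia.
  have [uk _] := fP kD.
  have P : d (f k) (f (d u x).-1) = (d u x).-1 - k by apply: path_dist; lia.
  have := d_tri u (f k) x; have := d_tri x (f (d u x).-1) (f k).
  by rewrite (d_sym (f k) x) (d_sym (f (d u x).-1)); lia.
- exact: n1.
have kD : D - (d v x).-1 <= D by lia.
have := d_tri u (f (D - (d v x).-1)) x; rewrite (d_sym (f _) x) n2.
by have [-> _] := fP kD; lia.
Qed.

(** Around either end, [y] has a level mate on the path, so it cannot separate [x] from the path
    vertex in the level of [x]. *)
Lemma off_path_unresolved : x != y ->
  d y (f (d u x)) = d y x /\ d y (f (D - d v x)) = d y x.
Proof.
move=> nxy; have [ux vx s] := off_path_coords xP; have [uy vy _] := off_path_coords yP.
have onP k : k <= D -> on_path (f k) by move=> kD; apply/on_pathP; exists k.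
have ny k : k <= D -> y != f k.
  by move=> kD; apply: contraNneq yP => ->; apply: onP.
have yx : y != x by rewrite eq_sym.
have [g [_ _ gP]] := geodesic_exists vu.
have kD : D - d v x <= D by lia.
split.
  apply: (@level_unresolved u f _ _ y (f (d u y))); rewrite ?ny ?d_le //.
  - by move=> k /fP[].
  - by have [] := fP (d_le u x).
  - by have [] := fP (d_le u y).
apply: (@level_unresolved v g _ _ y (f (D - d v y))); rewrite ?ny ?leq_subr //.
- by move=> k /gP[].
- by have [_ ->] := fP kD; rewrite subKn // ltnW.
- by have [_ ->] := fP (leq_subr (d v y) D); rewrite subKn // ltnW.
Qed.

End OffPath.

(** As [k] grows, [d x (f k)] strictly decreases up to [D - d v x] and strictly increases from
    [d u x]; an index strictly between can only be [(d u x).-1], at distance 1. The indices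
    [D - d v y < d u y] give the same value, which is not 1, so they lie on opposite sides. *)
Lemma off_path_coords_le x y : x != y -> ~~ on_path x -> ~~ on_path y ->
  (forall w, on_path w \/ w = x \/ w = y) -> d x y != 1 ->
  d u x <= d u y /\ d v x <= d v y.
Proof.
move=> nxy xP yP H s1.
have [ux vx sx] := off_path_coords xP; have [uy vy sy] := off_path_coords yP.
have [xq xp] : d x (f (d u y)) = d x y /\ d x (f (D - d v y)) = d x y.
  by apply: off_path_unresolved => //; rewrite eq_sym.
have s0 : d x y != 0 by rewrite d_eq0.
have [A B N C] := off_path_dist xP yP H s1.
have nq : d u y != (d u x).-1.
  by apply: contraNneq s1 => E; rewrite -xq E N.
have np : D - d v y != (d u x).-1.
  by apply: contraNneq s1 => E; rewrite -xp E N.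
have [lt_q|ge_q] := ltnP (d u y) (d u x).
  have Bq : d x y = d u x - d u y by rewrite -xq B //; clear -lt_q nq C vx; lia.
  have Bp : d x y = d u x - (D - d v y).
    by rewrite -xp B //; clear -lt_q nq C sy vy vx; lia.
  by clear -Bq Bp sy vy lt_q; lia.
split=> //; rewrite leqNgt; apply/negP => lt_p.
have Aq : d x y = d v x + d u y - D by rewrite -xq A //; clear -ge_q uy; lia.
have Ap : d x y = d v x + (D - d v y) - D.
  by rewrite -xp A //; clear -lt_p np C vx ux sx; lia.
by clear -Aq Ap sy vy vx lt_p; lia.
Qed.

Lemma off_path_false x y : x != y -> ~~ on_path x -> ~~ on_path y ->
  (forall w, on_path w \/ w = x \/ w = y) -> False.
Proof.
move=> nxy xP yP H.
have H' w : on_path w \/ w = y \/ w = x by case: (H w) => [|[]]; auto.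
have [ux vx sx] := off_path_coords xP; have [uy vy sy] := off_path_coords yP.
have [yq yp] := off_path_unresolved xP yP nxy.
have [xq xp] : d x (f (d u y)) = d x y /\ d x (f (D - d v y)) = d x y.
  by apply: off_path_unresolved => //; rewrite eq_sym.
have yx := d_sym y x.
have nE : ~ (d u x = d u y /\ d v x = d v y).
  by move=> /coord_eqP/coord_eq_eq E; rewrite E eqxx in nxy.
have [s1|s1] := eqVneq (d x y) 1.
  (* All four distances to the path are 1, so [d u y + d v x] and [d u x + d v y] are at most D + 1.
     As [sx] and [sy] bound the coordinate sums below by D + 1, the coordinates of [x] and [y]
     agree. *)
  have L w k : k <= D -> d w (f k) = 1 ->
      [/\ k <= d u w + 1, d u w <= k + 1, D - k <= d v w + 1 & d v w <= D - k + 1].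
    move=> kD E; have [E1 E2] := fP kD; have E' := d_sym w (f k).
    have := d_tri u w (f k); have := d_tri u (f k) w.
    have := d_tri v w (f k); have := d_tri v (f k) w.
    by split; lia.
  have [] := L x (d u y) (d_le _ _); first by lia.
  have [] := L x (D - d v y) (leq_subr _ _); first by lia.
  have [] := L y (d u x) (d_le _ _); first by lia.
  have [] := L y (D - d v x) (leq_subr _ _); first by lia.
  lia.
have [u1 v1] := off_path_coords_le nxy xP yP H s1.
have nyx : y != x by rewrite eq_sym.
have s1' : d y x != 1 by rewrite yx.
have [u2 v2] := off_path_coords_le nyx yP xP H' s1'.
by apply: nE; split; apply/eqP; rewrite eqn_leq ?u1 ?v1.
Qed.

End Antipodes.

Lemma uniquely_maximum_false u v : d u v = D -> False.
Proof.
move=> uv; have D0 : 0 < D.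
  have [x [y [_ _ nxy]]] := card_gt1P card_gt1.
  by apply: leq_trans (d_le x y); rewrite lt0n d_eq0.
have [f [f0 fD fP]] := geodesic_exists uv.
pose P := [set w | on_path f w].
have cP : #|P| = D.+1.
  have -> : P = [set f (val k) | k : 'I_D.+1].
    apply/setP => w; rewrite inE; apply/existsP/imsetP => [[k /eqP E]|[k _ E]].
      by exists k.
    by exists k; apply/eqP.
  rewrite card_imset ?card_ord // => k l /= E; apply: val_inj => /=.
  have [Ek _] := fP k (leq_ord k); have [El _] := fP l (leq_ord l).
  by rewrite -Ek -El E.
have /cards2P[x [y [nxy E]]] : #|~: P| == 2.
  by have := cardsC P; rewrite cP (card_T uv D0); lia.
have off w : ~~ on_path f w = (w == x) || (w == y).
  by have /setP/(_ w) := E; rewrite !inE.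
apply: (off_path_false uv D0 f0 fD fP nxy); rewrite ?off ?eqxx ?orbT //.
move=> w; case: (boolP (on_path f w)) => [|]; first by left.
by rewrite off => /orP[]/eqP->; right; [left|right].
Qed.

End GeodesicMetric.

(** * From unique bases to co-resolving sets *)

Section Resolving.
Variables (T : finType) (e : rel T).
Hypotheses (e_sym : symmetric e) (e_conn : forall u v, connect e u v).

(** A vertex of a resolving set separates itself from all others, so only pairs inside [C]
    matter. *)
Lemma resolvingC_co C : resolving e (~: C) <-> co_resolving (dist e) C.
Proof.
split=> [/resolvingP rC x y _ _ /rC[w]|cC].
  by rewrite inE => wC xy; exists w; rewrite // !(dist_sym e_sym e_conn w).
apply/resolvingP => x y nxy.
have [xC|xC] := boolP (x \in C); last first.
  exists x; rewrite ?inE //; have /eqP-> : dist e x x == 0 by rewrite dist_eq0.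
  by rewrite eq_sym dist_eq0 eq_sym.
have [yC|yC] := boolP (y \in C); last first.
  exists y; rewrite ?inE //; have /eqP-> : dist e y y == 0 by rewrite dist_eq0.
  by rewrite dist_eq0.
have [z zC] := cC x y xC yC nxy.
by rewrite !(dist_sym e_sym e_conn z) => R; exists z; rewrite ?inE.
Qed.

Lemma dist_le_diameter u v : dist e u v <= diameter e.
Proof.
apply: leq_trans (bigop.leq_bigmax (F := fun u => \max_v dist e u v) u).
exact: (bigop.leq_bigmax (F := dist e u)).
Qed.

Lemma diameter_attained : 0 < #|T| -> exists u v, dist e u v = diameter e.
Proof.
move=> T0; have [u Eu] := @bigop.eq_bigmax _ (fun u => \max_v dist e u v) T0.
have [v Ev] := @bigop.eq_bigmax _ (dist e u) T0.
by exists u, v; rewrite /diameter Eu Ev.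
Qed.

Lemma uniquely_dimensional_bound : 1 < #|T| -> uniquely_dimensional e ->
  metric_dimension e + diameter e + 2 <= #|T|.
Proof.
move=> T1 [W [bW uniqW]]; rewrite leqNgt; apply/negP => lt.
set D := diameter e in lt.
have d0 := dist_eq0 e; have ds := dist_sym e_sym e_conn.
have dtri := dist_triangle e_conn; have dstep := dist_step e_conn.
have dle := dist_le_diameter.
have [rW cW] := (metric_basis_card e W).1 bW.
have minW C : co_resolving (dist e) C -> metric_dimension e + #|C| <= #|T|.
  move=> /resolvingC_co rC; rewrite -cW addnC -(cardsC C) leq_add2l.
  by case: bW => _; apply.
have eqW C : co_resolving (dist e) C -> metric_dimension e + #|C| = #|T| ->
    ~: C = W.
  move=> /resolvingC_co rC E; apply/esym/uniqW/metric_basis_card; split=> //.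
  by have := cardsC C; lia.
have coW : co_resolving (dist e) (~: W) by apply/resolvingC_co; rewrite setCK.
have cCW := cardsC W.
have [u [v uv]] := diameter_attained (ltnW T1).
have D0 : 0 < D.
  have [x [y [_ _ nxy]]] := card_gt1P T1.
  by apply: leq_trans (dle x y); rewrite lt0n dist_eq0.
have [f [f0 fD fP]] := geodesic_exists d0 ds dtri dstep uv.
have injf k l : k <= D -> l <= D -> f k = f l -> k = l.
  by move=> /fP[Ek _] /fP[El _] E; rewrite -Ek -El E.
pose Pu := [set f (val k).+1 | k : 'I_D]; pose Pv := [set f (val k) | k : 'I_D].
have cPu : #|Pu| = D.
  rewrite card_imset ?card_ord // => k l /(injf _ _ (ltn_ord k) (ltn_ord l)).
  by move=> [/val_inj].
have cPv : #|Pv| = D.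
  rewrite card_imset ?card_ord // => k l.
  by move=> /(injf _ _ (ltnW (ltn_ord k)) (ltnW (ltn_ord l)))/val_inj.
have vPv : f D \notin Pv.
  apply/imsetP => -[k _ /(injf _ _ (leqnn D) (ltnW (ltn_ord k))) E].
  by have := ltn_ord k; rewrite /= -E ltnn.
have uPu : f 0 \notin Pu.
  by apply/imsetP => -[k _ /(injf _ _ (leq0n D) (ltn_ord k))].
have coPu : co_resolving (dist e) Pu.
  move=> _ _ /imsetP[k _ ->] /imsetP[l _ ->] nkl; exists (f 0) => //; rewrite f0.
  have [-> _] := fP _ (ltn_ord k); have [-> _] := fP _ (ltn_ord l).
  by apply: contraNneq nkl => ->.
have coPv : co_resolving (dist e) Pv.
  move=> _ _ /imsetP[k _ ->] /imsetP[l _ ->] nkl; exists (f D) => //; rewrite fD.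
  have kD := ltn_ord k; have lD := ltn_ord l.
  have [_ ->] := fP _ (ltnW kD); have [_ ->] := fP _ (ltnW lD).
  apply: contraNneq nkl => E; have -> // : val k = val l by rewrite /=; lia.
(* Both [Pu] and [Pv] would be the complement of the basis, but only [Pu] contains [f D]. *)
have beta_ne : metric_dimension e + D <> #|T|.
  move=> E; move/negP: vPv; apply.
  have -> : Pv = Pu by apply: setC_inj; rewrite !eqW ?cPu ?cPv.
  have lt' : D.-1 < D by rewrite prednK.
  by apply/imsetP; exists (Ordinal lt') => //=; rewrite prednK.
(* [minW] on [Pu] bounds the dimension by n - D; [beta_ne] and [lt] leave only n - D - 1. *)
have beta_eq : metric_dimension e + D.+1 = #|T|.
  by have := minW _ coPu; rewrite cPu; lia.
apply: (uniquely_maximum_false d0 ds dtri dstep dle _ _ T1 coW _ uv).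
- move=> C1 C2 co1 co2 card1 card2; apply: setC_inj.
  by rewrite !eqW ?card1 ?card2.
- by move=> C /minW; lia.
- by lia.
Qed.

End Resolving.

Local Open Scope ring_scope.

(** Integers avoid truncated subtraction. The one-vertex graph is excluded: its unique basis is
    empty, while n - d - 2 = -1. *)
Theorem theorem1 (T : finType) (e : rel T)
    (e_sym : symmetric e) (e_irr : irreflexive e)
    (e_conn : connected_graph e)
    (nontrivial : (1 < #|T|)%N)
    (e_unique : uniquely_dimensional e) :
  (metric_dimension e)%:Z <= #|T|%:Z - (diameter e)%:Z - 2%:Z.
Proof.
case: e_conn => _ conn.
by have := uniquely_dimensional_bound e_sym conn nontrivial e_unique; lia.
Qed.
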